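(* Let $t>1$ be odd, $G\cong\mathbb{Z}_t\times\mathbb{Z}_2^2$, and let $\mathcal{S}$ be the set of cocycles $\psi:G\times G\to\{\pm1\}$ of the form $\psi=\partial_{d_1}\cdots\partial_{d_k}\,\rho$. Let $H'$ be the group of permutations of $\mathcal{S}$ generated by the diagrammatic operations (complement, swappings, rotations, dilatations). Then the bundle action by $H=G\rtimes\mathrm{Aut}(G)$ on (the cocyclic matrices of) cocycles in $\mathcal{S}$ corresponds to the diagrammatic action by the subgroup $$H^*=\langle T_1,\ V_{r^{-1}}\ (r\in\mathbb{Z}_t^* ),\ s_{12}s_{34},\ s_{13}s_{24},\ C_2s_{23},\ s_{23}s_{24}\rangle\cong(\mathbb{Z}_t\rtimes\mathbb{Z}_t^* )\times S_4$$ of $H'$; that is, the group of permutations of $\mathcal{S}$ induced by the bundle action of $H$ is exactly $H^*$. Moreover $H^*$ has index $2$ in $H'$, and the operation $C_2$ is not in $H^*$.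
   Context: Let $t>1$ be odd and $G=\langle x,u,v: x^t=u^2=v^2=1,\ xu=ux,\ xv=vx,\ uv=vu\rangle\cong\mathbb{Z}_t\times\mathbb{Z}_2^2$. List the elements of $G$ as $g_1,\dots,g_{4t}$ with $g_{4j+1}=x^j$, $g_{4j+2}=x^ju$, $g_{4j+3}=x^jv$, $g_{4j+4}=x^juv$ for $0\le j\le t-1$. $\mathbb{Z}_t^*$ is the group of units of $\mathbb{Z}_t$ (acting on $\mathbb{Z}_t$ by multiplication in $\mathbb{Z}_t\rtimes\mathbb{Z}_t^*$), and $[m]_n$ denotes $m\bmod n$. A (normalized) cocycle is a map $\psi:G\times G\to\{\pm1\}$ with $\psi(g,1)=\psi(1,g)=1$ and $\psi(g,h)\psi(gh,k)=\psi(g,hk)\psi(h,k)$ for all $g,h,k\in G$; its cocyclic matrix is $M_\psi=[\psi(g,h)]_{g,h\in G}$ with rows and columns indexed by $G$ in the order $g_1,\dots,g_{4t}$. For $f:G\to\{\pm1\}$ put $\partial f(g,h)=f(g)^{-1}f(h)^{-1}f(gh)$. Let $\delta_i:G\to\{\pm1\}$ be $-1$ at $g_i$ and $1$ elsewhere. Put $\partial_i=\partial\delta_i$ for $2\le i\le 4t$, and let $\partial_1=-\partial\delta_1=\partial(-\delta_1)$ (the normalized version of $\partial\delta_1$). Let $\rho$ be the cocycle $\rho(x^ia,x^jb)=\rho_0(a,b)$ for $a,b\in\{1,u,v,uv\}$, where, with rows and columns ordered $1,u,v,uv$, $$[\rho_0(a,b)]=\begin{pmatrix}1&1&1&1\\1&-1&1&-1\\1&-1&-1&1\\1&1&-1&-1\end{pmatrix}.$$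 For $D\subseteq\{1,\dots,4t\}$ write $\psi_D=\big(\prod_{d\in D}\partial_d\big)\rho$ and $\mathcal{S}=\{\psi_D: D\subseteq\{1,\dots,4t\}\}$ (different $D$ may give the same cocycle). Diagrammatic operations. For $e\in\{1,2,3,4\}$ let $\mathbf{c}_e$ be the set of elements of $D$ congruent to $e$ modulo $4$. $\mathbf{c}_e+k$ is obtained by adding $k$ to each element modulo $4t$ (residues in $\{1,\dots,4t\}$). Define: - complement: $C_2$ replaces $\mathbf{c}_2$ by its complement in $\{d\in\{1,\dots,4t\}: d\equiv2\bmod 4\}$ and leaves $\mathbf{c}_3,\mathbf{c}_4,\mathbf{c}_1$ unchanged; - swappings: for $1\le a<b\le4$, $s_{ab}$ exchanges classes $a$ and $b$, i.e. the new class-$a$ set is $\mathbf{c}_b-(b-a)$, the new class-$b$ set is $\mathbf{c}_a+(b-a)$, and the other two are unchanged; - rotations: $T_i$ ($0\le i\le t-1$) replaces each $\mathbf{c}_e$ by $\mathbf{c}_e-4i$; - dilatations: for $r\in\mathbb{Z}_t^*$, $V_r$ sends each $4j+e\in D$ ($0\le j\le t-1$, $1\le e\le4$) to $4[jr]_t+e$. Each operation $F$ is regarded as an operation on cocycles of $\mathcal{S}$ by $F(\psi_D)=\psi_{F(D)}$; products denote composition. Bundle action. For $a\in G$ the shift of $\psi$ is $(\psi\cdot a)(g,h)=\psi(ag,h)\psi(a,h)^{-1}$; for $\theta\in\mathrm{Aut}(G)$ the automorphism action of $\theta$ is $\psi\mapsto\psi\circ(\theta\times\theta)$. The bundle action is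 the combined action by $H=G\rtimes\mathrm{Aut}(G)$, $\psi\mapsto(\psi\cdot a)\circ(\theta\times\theta)$ for $a\in G$, $\theta\in\mathrm{Aut}(G)$. *)

(* Defs.v *)
From HB Require Import structures.
From mathcomp Require Import all_boot all_order all_algebra.
From mathcomp Require Import all_fingroup all_solvable.

Set Implicit Arguments.
Unset Strict Implicit.
Unset Printing Implicit Defensive.

Import GRing.Theory.
Local Open Scope ring_scope.

Section Cocycles.

Variable t : nat.

(* The group law is written multiplicatively in group_scope; on 'Z_n it is
   addition. *)
Definition G : finGroupType := ('Z_t * ('Z_2 * 'Z_2))%type.

Definition gx : G := (1, (0, 0)).
Definition gu : G := (0, (1, 0)).
Definition gv : G := (0, (0, 1)).

(* Index set {1, ..., 4t} as residues modulo 4t; the index 4t is the residue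
   0.  The decomposition d = 4j + e with 0 <= j < t and 1 <= e <= 4 is read off
   the representative of d - 1 in {0, ..., 4t - 1}. *)
Definition idx := 'Z_(4 * t).
Definition qidx (d : idx) : nat := ((d - 1)%R : nat) %/ 4.
Definition cidx (d : idx) : nat := (((d - 1)%R : nat) %% 4).+1.

Definition elt (d : idx) : G :=
  (gx ^+ qidx d * nth 1 [:: 1; gu; gv; gu * gv] (cidx d).-1)%g.

Definition table := {ffun G * G -> int}.

Definition cocycle (psi : table) : Prop :=
  [/\ forall g h, psi (g, h) = 1 \/ psi (g, h) = -1,
      forall g, psi (g, 1%g) = 1 /\ psi (1%g, g) = 1
    & forall g h k,
        psi (g, h) * psi ((g * h)%g, k) = psi (g, (h * k)%g) * psi (h, k)].

Definition coboundary (f : G -> int) : table :=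
  [ffun gh => (f gh.1)^-1 * (f gh.2)^-1 * f (gh.1 * gh.2)%g].

Definition delta (d : idx) (g : G) : int := if g == elt d then -1 else 1.

Definition elem_coboundary (d : idx) : table :=
  if d == 1 then coboundary (fun g => - delta d g) else coboundary (delta d).

Definition rho0 : 'M[int]_4 :=
  \matrix_(a, b) nth 0 (nth [::] [:: [:: 1;  1;  1;  1];
                                     [:: 1; -1;  1; -1];
                                     [:: 1; -1; -1;  1];
                                     [:: 1;  1; -1; -1]] a) b.

(* Position of u^p v^q in the list 1, u, v, uv, for g = x^i u^p v^q. *)
Definition klein_pos (g : G) : 'I_4 := inord (g.2.1 + 2 * g.2.2)%N.

Definition rho : table := [ffun gh => rho0 (klein_pos gh.1) (klein_pos gh.2)].

Definition psi (D : {set idx}) : table :=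
  [ffun gh => (\prod_(d in D) elem_coboundary d gh) * rho gh].

Definition calS : finType := seq_sub (codom psi).

Definition psiS (D : {set idx}) : calS := SeqSub (codom_f psi D).

Definition lane (e : nat) : {set idx} := [set d : idx | d == e %[mod 4]].
Definition cls (e : nat) (D : {set idx}) : {set idx} := D :&: lane e.
Definition translate (k : idx) (A : {set idx}) : {set idx} :=
  [set d + k | d in A].

Definition C2 (D : {set idx}) : {set idx} :=
  (lane 2 :\: cls 2 D) :|: (cls 3 D :|: cls 4 D :|: cls 1 D).

Definition swapping (a b : nat) (D : {set idx}) : {set idx} :=
  translate (- (b - a)%:R) (cls b D) :|: translate (b - a)%:R (cls a D)
    :|: (D :\: (lane a :|: lane b)).

Definition rotation (i : nat) (D : {set idx}) : {set idx} :=
  \bigcup_(e in [set: 'I_4]) translate (- (4 * i)%:R) (cls e.+1 D).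

Definition dilatation (r : {unit 'Z_t}) (D : {set idx}) : {set idx} :=
  [set (4 * ((qidx d * (val r : nat)) %% t) + cidx d)%:R | d in D].

Inductive diag_op : ({set idx} -> {set idx}) -> Prop :=
| DiagComplement : diag_op C2
| DiagSwap a b of (0 < a < b)%N & (b <= 4)%N : diag_op (swapping a b)
| DiagRot i of (i < t)%N : diag_op (rotation i)
| DiagDil r : diag_op (dilatation r).

(* The permutation psi_D |-> psi_{F(D)} of calS when it is well defined, and the
   identity otherwise. *)
Definition op_perm (F : {set idx} -> {set idx}) : {perm calS} :=
  odflt 1%g [pick p : {perm calS} | [forall D, p (psiS D) == psiS (F D)]].

Definition Hprime : {group {perm calS}} :=
  <<[set op_perm C2]
    :|: [set op_perm (swapping ab.1 ab.2)
          | ab : 'I_5 * 'I_5 & (0 < ab.1 < ab.2)%N]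
    :|: [set op_perm (rotation i) | i : 'I_t]
    :|: [set op_perm (dilatation r) | r : {unit 'Z_t}]>>%G.

Definition Hstar : {group {perm calS}} :=
  <<[set op_perm (rotation 1)]
    :|: [set op_perm (dilatation r^-1%g) | r : {unit 'Z_t}]
    :|: [set op_perm (swapping 1 2 \o swapping 3 4);
             op_perm (swapping 1 3 \o swapping 2 4);
             op_perm (C2 \o swapping 2 3);
             op_perm (swapping 2 3 \o swapping 2 4)]>>%G.

Definition shift (a : G) (f : table) : table :=
  [ffun gh => f ((a * gh.1)%g, gh.2) * (f (a, gh.2))^-1].

Definition aut_act (theta : {perm G}) (f : table) : table :=
  [ffun gh => f (theta gh.1, theta gh.2)].

Definition bundle (a : G) (theta : {perm G}) (f : table) : table :=
  aut_act theta (shift a f).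

(* Permutations of calS induced by the elements (a, theta) of G ><| Aut(G). *)
Definition bundle_perms : {set {perm calS}} :=
  [set p : {perm calS} |
    [exists a : G, exists theta in Aut [set: G],
       forall s : calS, ssval (p s) == bundle a theta (ssval s)]].

End Cocycles.

(* Main.v *)
Require Import Defs.
From HB Require Import structures.
From mathcomp Require Import all_boot all_order all_algebra.
From mathcomp Require Import all_fingroup all_solvable.
From mathcomp Require Import zify.

(** A cocycle of S is a sign with a boolean exponent.  If f is the indicator
    function on G of the elements indexed by D, then psi_D(g, h) is -1 to the
    power f(1) + f(g) + f(h) + f(gh) + b(g, h), where b is the exponent of rho.
    The point is that b is a bilinear form on the Klein quotient F_2^2 of G,
    namely b((p, q), (p', q')) = pp' + qp' + qq' ([rhoE], [psiE]).  Since t is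
    odd, the part coming from f vanishes exactly when f is an affine function
    on the Klein quotient ([cob_eq0P]).  So S is the space of functions
    G -> F_2 modulo the affine functions of the lane, where the lanes are the
    four fibres of G -> F_2^2.

    The group Hol(Z_t) x S_4 acts on G by affine maps on the factor Z_t and by
    arbitrary permutations of the lanes.  Every permutation of the four points
    of F_2^2 is affine ([perm_affine]), so this action preserves the affine
    functions of the lane and descends to S.  Complementing a lane also
    descends to S; it does not matter which lane, because the indicators of two
    lanes differ by an affine function ([affine_lanes]).  This gives an action
    of Hol(Z_t) x S_4 x Z_2 on S, which is faithful because a lane has at least
    three elements ([act_perm_inj]).  Every diagrammatic operation is one of
    these permutations ([diag_induces]), and together they give all of them.

    The maps g |-> a theta(g), for a in G and theta in Aut(G), are exactly the
    elements of Hol(Z_t) x S_4 ([bundle_of_act], [act_of_bundle]).  Shifting by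
    a does not change rho, by bilinearity of b.  Composing with theta changes b
    by 0 or by the alternating form, according to the sign of the lane
    permutation ([bform_linpart]); and the alternating form is the coboundary
    of the indicator of a lane ([cob_lane]).  Hence the bundle action of
    (a, theta) moves the indicator function by an element k of Hol(Z_t) x S_4
    and complements a lane exactly when k permutes the lanes oddly
    ([bundle_psi]).  These permutations form the graph of the sign inside
    (Hol(Z_t) x S_4) x Z_2: a subgroup isomorphic to Hol(Z_t) x S_4, of index
    2, which misses C_2.  The generators of H* lie in this graph and generate
    it ([Hstar_signed]). *)

Section DiagrammaticOperations.
Set Implicit Arguments.
Unset Strict Implicit.
Unset Printing Implicit Defensive.
Import GRing.Theory.
Local Open Scope ring_scope.

Variable t : nat.
Hypotheses (t_gt1 : (1 < t)%N) (t_odd : odd t).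

Local Notation G := (G t).
Local Notation idx := (idx t).
Local Notation pos := (@klein_pos t).

(** * Coordinates on the group and its index set *)

(** The bits of the Klein component make every statement about lanes a finite
    boolean computation. *)
Definition ubit (g : G) : bool := odd g.2.1.
Definition vbit (g : G) : bool := odd g.2.2.

Definition mkG (j : 'Z_t) (e : 'I_4) : G := (j, ((odd e)%:R, (1 < e)%:R)).

Lemma natr_odd_Z2 (z : 'Z_2) : (odd z)%:R = z.
Proof. by apply: val_inj; case: z => [[|[|//]] ?]. Qed.

Lemma odd_Z2M (z w : 'Z_2) : odd (z * w)%g = odd z (+) odd w.
Proof. by case: z w => [[|[|//]] ?] [[|[|//]] ?]. Qed.

Lemma pos_val g : pos g = (ubit g + vbit g * 2)%N :> nat.
Proof.
rewrite /klein_pos /ubit /vbit.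
case: g => j [[[|[|//]] ?] [[|[|//]] ?]] /=; by rewrite inordK.
Qed.

Lemma odd_pos g : odd (pos g) = ubit g.
Proof. by rewrite pos_val; case: (ubit g) (vbit g) => [] []. Qed.
Lemma lt1_pos g : (1 < pos g)%N = vbit g.
Proof. by rewrite pos_val; case: (ubit g) (vbit g) => [] []. Qed.

Lemma mkG_pos g : mkG g.1 (pos g) = g.
Proof.
rewrite /mkG odd_pos lt1_pos /ubit /vbit !natr_odd_Z2.
by case: g => ? [].
Qed.

Lemma ubit_mkG j e : ubit (mkG j e) = odd e.
Proof. by rewrite /ubit /=; case: (odd e). Qed.
Lemma vbit_mkG j e : vbit (mkG j e) = (1 < e)%N.
Proof. by rewrite /vbit /=; case: (1 < e)%N. Qed.

Lemma pos_mkG j e : pos (mkG j e) = e.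
Proof.
apply: val_inj; rewrite /= pos_val ubit_mkG vbit_mkG.
by case: e => [[|[|[|[|//]]]] ?].
Qed.

Lemma ubitM g h : ubit (g * h)%g = ubit g (+) ubit h.
Proof. exact: odd_Z2M. Qed.
Lemma vbitM g h : vbit (g * h)%g = vbit g (+) vbit h.
Proof. exact: odd_Z2M. Qed.

Lemma G_ext (g h : G) : g.1 = h.1 -> ubit g = ubit h -> vbit g = vbit h -> g = h.
Proof.
move=> e1 e2 e3; rewrite -[g]mkG_pos -[h]mkG_pos e1; congr mkG.
by apply: val_inj; rewrite /= !pos_val e2 e3.
Qed.

Lemma fstM (g h : G) : (g * h)%g.1 = g.1 + h.1. Proof. by []. Qed.

Definition index_of (g : G) : idx := (4 * (g.1 : nat) + pos g + 1)%:R.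

Lemma t4_gt1 : (1 < 4 * t)%N. Proof. lia. Qed.

Lemma ltn_Zt (j : 'Z_t) : (j < t)%N.
Proof. by case: j => m /=; rewrite (Zp_cast t_gt1). Qed.

Lemma index_of_sub1 g : ((index_of g - 1)%R : nat) = (4 * (g.1 : nat) + pos g)%N.
Proof.
rewrite /index_of natrD addrK (val_Zp_nat t4_gt1) modn_small //.
have := ltn_Zt g.1; have := ltn_ord (pos g). lia.
Qed.

Lemma qidx_index_of g : qidx (index_of g) = g.1.
Proof. by rewrite /qidx index_of_sub1 mulnC divnMDl // divn_small ?addn0. Qed.
Lemma cidx_index_of g : cidx (index_of g) = (pos g).+1.
Proof. by rewrite /cidx index_of_sub1 mulnC modnMDl modn_small. Qed.

Lemma gxX n : (gx t ^+ n)%g = (n%:R, 1%g) :> G.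
Proof.
elim: n => [|n IH]; first by [].
rewrite expgSr IH; apply: G_ext.
- by rewrite fstM /= -[in RHS]natr1.
- by rewrite ubitM.
- by rewrite vbitM.
Qed.

Lemma index_ofK : cancel index_of (@elt t).
Proof.
move=> g; rewrite /elt qidx_index_of cidx_index_of gxX natr_Zp /=.
have uv1 : (gu t).1 + (gv t).1 = 0 by exact: addr0.
rewrite -[RHS]mkG_pos; case: (pos g) => [[|[|[|[|//]]]] lt4] /=;
  apply: G_ext; rewrite ?(ubitM, vbitM, ubit_mkG, vbit_mkG) //.
- by rewrite !fstM addr0.
- by rewrite !fstM addr0.
- by rewrite !fstM addr0.
- by rewrite !fstM uv1 addr0.
Qed.

Lemma card_idx : #|idx| = #|G|.
Proof.
rewrite !card_prod !card_ord !Zp_cast // ?t4_gt1 //. lia.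
Qed.

Lemma index_of_bij : bijective index_of.
Proof. by apply: inj_card_bij; rewrite ?card_idx //; apply: can_inj index_ofK. Qed.

Lemma eltK : cancel (@elt t) index_of.
Proof. exact: (bij_can_sym index_of_bij _).2 index_ofK. Qed.

(** * Cocycles as boolean exponents *)

Definition indic (D : {set idx}) (g : G) : bool := index_of g \in D.
(** The exponent of the normalised coboundary of (-1)^f: the term f(1) is what
    the replacement of d_1 by its negative contributes. *)
Definition cob (f : G -> bool) (g h : G) : bool :=
  f 1%g (+) f g (+) f h (+) f (g * h)%g.
(** The exponent of rho, as a bilinear form in the Klein bits. *)
Definition bform (g h : G) : bool :=
  ubit g && ubit h (+) vbit g && ubit h (+) vbit g && vbit h.

Lemma bformDl g g' h : bform (g * g')%g h = bform g h (+) bform g' h.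
Proof.
rewrite /bform !ubitM !vbitM.
by case: (ubit g) (ubit g') (vbit g) (vbit g') (ubit h) (vbit h)
  => [] [] [] [] [] [].
Qed.
Lemma bformDr g h h' : bform g (h * h')%g = bform g h (+) bform g h'.
Proof.
rewrite /bform !ubitM !vbitM.
by case: (ubit g) (ubit h') (vbit g) (vbit h') (ubit h) (vbit h)
  => [] [] [] [] [] [].
Qed.

Lemma rhoE g h : rho t (g, h) = (-1) ^+ bform g h.
Proof.
rewrite ffunE mxE !pos_val /bform.
by case: (ubit g) (vbit g) (ubit h) (vbit h) => [] [] [] [].
Qed.

Lemma elt_index1 : elt (1 : idx) = 1%g.
Proof.
rewrite -[RHS]index_ofK; congr elt.
by rewrite /index_of pos_val /= muln0.
Qed.

Lemma signV (b : bool) : ((-1) ^+ b)^-1 = (-1) ^+ b :> int.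
Proof. by case: b. Qed.

(** For d = 1 the extra sign is the value of delta_1 at the identity; for the
    other indices that value is 1.  One formula covers both cases. *)
Lemma elem_coboundaryE d g h :
  elem_coboundary d (g, h) = (-1) ^+ cob (fun x => x == elt d) g h.
Proof.
have dE x : delta d x = (-1) ^+ (x == elt d) :> int.
  by rewrite /delta; case: ifP.
rewrite /elem_coboundary; case: eqP => [d1|/eqP d1]; rewrite ffunE /= !dE /cob.
  rewrite d1 elt_index1 eqxx.
  by move: (g == 1%g) (h == 1%g) ((g * h)%g == 1%g) => [] [] [].
have -> : (1%g == elt d :> G) = false.
  by apply: contra_neqF d1 => /eqP e; rewrite -[d]eltK -e -elt_index1 eltK.
by move: (g == elt d) (h == elt d) ((g * h)%g == elt d) => [] [] [].
Qed.

(** As d ranges over D, at most one delta_d is negative at x. *)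
Lemma prod_indic (D : {set idx}) (x : G) :
  \prod_(d in D) (-1) ^+ (x == elt d) = (-1) ^+ indic D x :> int.
Proof.
rewrite /indic; have [xD|xD] := boolP (index_of x \in D).
  rewrite (bigD1 (index_of x)) //= index_ofK eqxx big1 ?mulr1 // => d /andP[_ dx'].
  by case: eqP => // xd; move: dx'; rewrite xd eltK eqxx.
rewrite big1 // => d dD; case: eqP => // xd.
by move: xD; rewrite xd eltK dD.
Qed.

Lemma psiE D g h : psi D (g, h) = (-1) ^+ (cob (indic D) g h (+) bform g h).
Proof.
rewrite ffunE rhoE signr_addb; congr (_ * _).
under eq_bigr => d _ do rewrite elem_coboundaryE /cob !signr_addb.
by rewrite !big_split /= !prod_indic -!signr_addb.
Qed.

Lemma sign_inj (b c : bool) : (-1) ^+ b = (-1) ^+ c :> int -> b = c.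
Proof. by case: b c => [] []. Qed.

Lemma psi_eqP D D' :
  psi D = psi D' <-> forall g h, cob (indic D) g h = cob (indic D') g h.
Proof.
split=> [e g h|e].
  apply: (can_inj (addbK (bform g h))); apply: sign_inj.
  by rewrite -!psiE e.
by apply/ffunP => -[g h]; rewrite !psiE e.
Qed.

Lemma psi_cocycle (D : {set idx}) : cocycle (psi D).
Proof.
split=> [g h|g|g h k]; first by rewrite psiE; case: (_ (+) _); [right|left].
  have u1 : ubit 1 = false by []. have v1 : vbit 1 = false by [].
  rewrite !psiE /cob /bform mulg1 mul1g u1 v1 !andbF /=.
  by case: (indic _ _) (indic _ _) => [] [].
rewrite !psiE -!signr_addb; congr (_ ^+ nat_of_bool _).
rewrite bformDl bformDr /cob mulgA.
by move: (indic D _) (indic D _) (indic D _) (indic D _) (indic D _)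
  (indic D _) (indic D _) => [] [] [] [] [] [] [] /=;
case: (bform g h) (bform g k) (bform h k) => [] [] [].
Qed.

(** * Which sets of indices give the same cocycle *)

Definition affine (f : G -> bool) :=
  exists a b c, forall g, f g = a (+) b && ubit g (+) c && vbit g.

Lemma cob_add f f' g h :
  cob (fun x => f x (+) f' x) g h = cob f g h (+) cob f' g h.
Proof.
rewrite /cob.
by move: (f _) (f _) (f _) (f _) (f' _) (f' _) (f' _) (f' _) =>
 [] [] [] [] [] [] [] [].
Qed.

(** As t is odd, every element of Z_t is a double, so that every homomorphism
    from Z_t to a group of exponent 2 is trivial. *)
Lemma half_Zt (j : 'Z_t) : exists i : 'Z_t, j = i + i.
Proof.
(* (t + 1) / 2 is the inverse of 2 modulo t. *)
exists (j *+ (t.+1)./2); rewrite -mulrnDr.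
have -> : ((t.+1)./2 + (t.+1)./2 = t + 1)%N by lia.
by rewrite mulrnDr -[j *+ t]mulr_natr pchar_Zp // mulr0 add0r.
Qed.

(** A vanishing coboundary makes f - f(1) a homomorphism G -> F_2.  It kills
    the squares, hence the whole factor Z_t, and so it is a linear form in the
    two Klein bits. *)
Lemma cob_eq0P f : (forall g h, cob f g h = false) <-> affine f.
Proof.
split=> [f0|[a [b [c fE]]] g h]; last first.
  rewrite /cob !fE ubitM vbitM {fE}.
  by case: a b c (ubit g) (vbit g) (ubit h) (vbit h) => [] [] [] [] [] [] [].
have f0' g h : f (g * h)%g = f 1%g (+) f g (+) f h.
  by have := f0 g h; rewrite /cob; case: (f (g * h)%g) (f 1%g (+) f g (+) f h) => [] [].
have fx j : f (j, 1%g) = f 1%g.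
  have [i ->] := half_Zt j.
  have -> : (i + i, 1%g) = ((i, 1%g) * (i, 1%g) : G)%g by apply: G_ext.
  by rewrite f0' -addbA addbb addbF.
exists (f 1%g), (f 1%g (+) f (gu t)), (f 1%g (+) f (gv t)) => g.
have -> : g = ((g.1, 1%g) *
  ((if ubit g then gu t else 1) * (if vbit g then gv t else 1)))%g.
  apply: G_ext.
  - by rewrite !fstM; case: ifP; case: ifP; rewrite !addr0.
  - by rewrite !ubitM; case: ifP; case: ifP.
  - by rewrite !vbitM; case: ifP; case: ifP.
rewrite !f0' fx !ubitM !vbitM; case: (ubit g); case: (vbit g);
by move: (f _) (f _) (f _) => [] [] [].
Qed.

Lemma affineD f f' : affine f -> affine f' -> affine (fun g => f g (+) f' g).
Proof.
move=> [a [b [c fE]]] [a' [b' [c' fE']]].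
exists (a (+) a'), (b (+) b'), (c (+) c') => g; rewrite fE fE' {fE fE'}.
by move: (ubit g) (vbit g) => [] []; case: a b c a' b' c' => [] [] [] [] [] [].
Qed.

Lemma eq_affine f f' : f =1 f' -> affine f -> affine f'.
Proof. by move=> e [a [b [c fE]]]; exists a, b, c => g; rewrite -e. Qed.

Lemma affine_andb b f : affine f -> affine (fun g => b && f g).
Proof. by case: b => //; exists false, false, false. Qed.

Lemma affine_const a : affine (fun _ => a).
Proof. by exists a, false, false => g; rewrite !addbF. Qed.

Lemma psi_affineP (D D' : {set idx}) :
  psi D = psi D' <-> affine (fun g => indic D g (+) indic D' g).
Proof.
rewrite psi_eqP -cob_eq0P; split=> e g h; last first.
  by have := e g h; rewrite cob_add; case: (cob _ _ _) (cob _ _ _) => [] [].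
by rewrite cob_add e addbb.
Qed.

(** * The action of Hol(Z_t) x S_4 on G and on S *)

(** On F_2^2 a function is affine exactly when its four values have even sum,
    and permuting the points does not change that sum. *)
Lemma perm_affine (p : pred 'I_4) (s : {perm 'I_4}) :
  \big[addb/false]_i p i = false -> affine (fun g => p (s (pos g))).
Proof.
rewrite (reindex_inj (@perm_inj _ s)) /= !big_ord_recl big_ord0 /= => sum0.
pose o i : 'I_4 := inord i.
have oE g : pos g = o (ubit g + vbit g * 2)%N.
  by rewrite /o -pos_val inord_val.
move: sum0.
rewrite (_ : ord0 = o 0%N); last by apply: val_inj; rewrite /= inordK.
rewrite (_ : lift _ _ = o 1%N); last by apply: val_inj; rewrite /= !inordK.
rewrite (_ : lift _ _ = o 2); last by apply: val_inj; rewrite /= !inordK.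
rewrite (_ : lift _ _ = o 3); last by apply: val_inj; rewrite /= !inordK.
move=> sum0.
exists (p (s (o 0))), (p (s (o 0)) (+) p (s (o 1%N))), (p (s (o 0)) (+) p (s (o 2))) => g.
rewrite oE; case: (ubit g) (vbit g) => [] [] /=; move: sum0; rewrite ?addnn /=.
all: by case: (p _) (p _) (p _) (p _) => [] [] [] [].
Qed.

(** In the first component, the pair (r, i) stands for the affine map
    j |-> jr + i; with this order the action below is a right action, as the
    composition of permutations is. *)
Definition holSym : finGroupType :=
  (sdprod_by (FinRing.unit_groupAction 'Z_t) * {perm 'I_4})%type.

Definition actG (k : holSym) (g : G) : G :=
  mkG (g.1 * val k.1.1 + k.1.2) (k.2 (pos g)).

Lemma actGM k l g : actG (k * l)%g g = actG l (actG k g).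
Proof.
rewrite /actG pos_mkG; congr mkG; last by rewrite permM.
by rewrite /= !FinRing.unit_actE mulrDl -mulrA addrA.
Qed.

Lemma actG1 g : actG 1%g g = g.
Proof. by rewrite /actG perm1 /= mulr1 addr0 mkG_pos. Qed.

Lemma actGK k : cancel (actG k) (actG k^-1%g).
Proof. by move=> g; rewrite -actGM mulgV actG1. Qed.
Lemma actGVK k : cancel (actG k^-1%g) (actG k).
Proof. by move=> g; rewrite -actGM mulVg actG1. Qed.

(** This is what makes the action descend to S. *)
Lemma affine_actG f k : affine f -> affine (f \o actG k).
Proof.
move=> [a [b [c fE]]]; apply: (@eq_affine
  (fun g => a (+) b && odd (k.2 (pos g)) (+) c && (1 < k.2 (pos g))%N)).
  by move=> g /=; rewrite fE ubit_mkG vbit_mkG.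
apply: affineD; first apply: affineD; first exact: affine_const.
  by apply/affine_andb/(@perm_affine (fun i => odd i)); rewrite !big_ord_recl big_ord0.
by apply/affine_andb/(@perm_affine (fun i => 1 < i)%N); rewrite !big_ord_recl big_ord0.
Qed.

(** The alternating form on the Klein quotient. *)
Definition altform (g h : G) : bool := ubit g && vbit h (+) vbit g && ubit h.

(** The indicator of a lane differs by an affine function from the product of
    the two bits, and [altform] is the polarisation of this product. *)
Lemma cob_lane e g h : cob (fun x => pos x == e) g h = altform g h.
Proof.
rewrite /cob /altform -!val_eqE /= !pos_val ubitM vbitM.
case: e => [[|[|[|[|//]]]] ?] /=;
by case: (ubit g) (vbit g) (ubit h) (vbit h) => [] [] [] [].
Qed.

Definition uv_lane (g : G) : bool := ubit g && vbit g.

Lemma uv_laneE g : uv_lane g = (pos g == ord_max).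
Proof.
by rewrite /uv_lane -val_eqE /= pos_val; case: (ubit g) (vbit g) => [] [].
Qed.

Lemma affine_lanes e e' : affine (fun g => (pos g == e) (+) (pos g == e')).
Proof. by apply/cob_eq0P => g h; rewrite cob_add !cob_lane addbb. Qed.

Lemma affine_lane_moved k e e' :
  affine (fun g => (pos (actG k g) == e) (+) (pos g == e')).
Proof.
apply: eq_affine (affine_lanes (k.2^-1%g e) e') => g; congr (_ (+) _).
by rewrite pos_mkG -(inj_eq (@perm_inj _ k.2)) permKV.
Qed.

(** Move D by k, then complement one fixed lane if b holds; the choice of the
    lane of uv makes its indicator the product of the two bits. *)
Definition act_set (k : holSym) (b : bool) (D : {set idx}) : {set idx} :=
  [set d | indic D (actG k^-1%g (elt d)) (+) b && uv_lane (elt d)].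

Lemma indic_act_set k b D g :
  indic (act_set k b D) g = indic D (actG k^-1%g g) (+) b && uv_lane g.
Proof. by rewrite /indic inE index_ofK. Qed.

Lemma psi_act_set k b D D' : psi D = psi D' -> psi (act_set k b D) = psi (act_set k b D').
Proof.
move=> /psi_affineP/(affine_actG k^-1%g) aff; apply/psi_affineP.
by apply: eq_affine aff => g; rewrite !indic_act_set /= addbACA addbb addbF.
Qed.

(** On sets this fails: k carries the complemented lane to another one.  It
    holds on cocycles because the two lane indicators differ by an affine
    function. *)
Lemma psi_act_setM k b l c D :
  psi (act_set l c (act_set k b D)) = psi (act_set (k * l)%g (b (+) c) D).
Proof.
apply/psi_affineP.
apply: eq_affine (affine_andb b (affine_lane_moved l^-1%g ord_max ord_max)) => g.
rewrite !indic_act_set invMg actGM !uv_laneE.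
by case: b c (indic _ _) (_ == _) (_ == _) => [] [] [] [] [].
Qed.

Lemma psi_act_set1 D : psi (act_set 1%g false D) = psi D.
Proof.
by apply/psi_affineP; apply: eq_affine (affine_const false) => g;
  rewrite indic_act_set invg1 actG1 addbF addbb.
Qed.

Local Notation calS := (calS t).

Lemma psiS_eqP (D D' : {set idx}) : psiS D = psiS D' <-> psi D = psi D'.
Proof. by split=> [[]//|e]; apply: val_inj. Qed.

Lemma psiS_onto (s : calS) : exists D, s = psiS D.
Proof. by have /codomP[D e] := ssvalP s; exists D; apply: val_inj. Qed.

Lemma op_permE (F : {set idx} -> {set idx}) (p : {perm calS}) :
  (forall D, p (psiS D) = psiS (F D)) -> op_perm F = p.
Proof.
move=> pF; rewrite /op_perm; case: pickP => [q /forallP qF | /(_ p)/forallP[]].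
  by apply/permP => s; have [D ->] := psiS_onto s; rewrite (eqP (qF D)) pF.
by move=> D; rewrite pF.
Qed.

Definition act_perm k b : {perm calS} := op_perm (act_set k b).

(** Since [act_set] respects equality of cocycles and [act_set k^-1 b] undoes
    it, choosing a preimage of each cocycle defines a permutation of S. *)
Lemma act_permE k b D : act_perm k b (psiS D) = psiS (act_set k b D).
Proof.
pose rep (s : calS) : {set idx} := iinv (ssvalP s).
have repK s : psiS (rep s) = s by apply: val_inj; rewrite /= f_iinv.
pose f s := psiS (act_set k b (rep s)).
have fE E : f (psiS E) = psiS (act_set k b E).
  by apply/psiS_eqP/psi_act_set/psiS_eqP.
have f_inj : injective f.
  move=> s s'; rewrite -[s]repK -[s']repK !fE => /psiS_eqP/(psi_act_set k^-1%g b).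
  by rewrite !psi_act_setM mulgV addbb !psi_act_set1 => /psiS_eqP.
rewrite /act_perm (@op_permE _ (perm f_inj)) => [|E]; by rewrite permE fE.
Qed.

Lemma op_perm_induced F k b :
  (forall D, psi (F D) = psi (act_set k b D)) -> op_perm F = act_perm k b.
Proof. by move=> FE; apply: op_permE => D; rewrite act_permE; apply/esym/psiS_eqP. Qed.

Lemma act_permM k b l c : act_perm (k * l)%g (b (+) c) = (act_perm k b * act_perm l c)%g.
Proof.
by apply: op_permE => D; rewrite permM !act_permE; apply/psiS_eqP/psi_act_setM.
Qed.

Lemma act_perm1 : act_perm 1%g false = 1%g.
Proof. by apply: op_permE => D; rewrite perm1; apply/psiS_eqP; rewrite psi_act_set1. Qed.

Lemma actG_faithful k : (forall g, actG k g = g) -> k = 1%g.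
Proof.
move=> kE.
have k2 : k.2 = 1%g.
  by apply/permP => e; have := kE (mkG 0 e); rewrite /actG pos_mkG => /(congr1 pos);
    rewrite !pos_mkG perm1.
have k12 : k.1.2 = 0.
  by have := congr1 fst (kE (mkG 0 ord0)); rewrite /= mul0r add0r.
have k11 : k.1.1 = 1%g.
  by apply: val_inj; have := congr1 fst (kE (mkG 1 ord0)); rewrite /= k12 mul1r addr0.
case: k k2 k12 k11 {kE} => [[[a x] p] s] /= -> x0 a1.
by congr (_, _); apply: val_inj; rewrite /= a1 x0.
Qed.

(** Two kinds of sets detect a nontrivial element.  On the empty set, the complemented lane would be an affine function unless b is false.
    On a singleton {g} with kg <> g, the set {g, kg} would be a union of lanes,
    but the lane of g has at least three elements. *)
Lemma act_perm_inj k b : act_perm k b = 1%g -> k = 1%g /\ b = false.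
Proof.
move=> act_eq1.
have fixd D : affine (fun g => indic (act_set k b D) g (+) indic D g).
  by apply/psi_affineP/psiS_eqP; rewrite -act_permE act_eq1 perm1.
have b0 : b = false.
  have [x [y [z E]]] := fixd set0.
  have := (E 1%g, E (gu t), E (gv t), E (gu t * gv t)%g).
  rewrite !indic_act_set /indic !inE /uv_lane !ubitM !vbitM /=.
  by case: b x y z {E act_eq1 fixd} => [] [] [] [] [[[]]].
split=> //; apply: actG_faithful => g.
apply/eqP; apply: contraT => kg.
have [x [y [z E]]] := fixd [set index_of g].
have indicg h : indic [set index_of g] h = (h == g).
  by rewrite /indic inE (inj_eq (can_inj index_ofK)).
have {E} kE (j : 'Z_t) : j != 0 -> actG k g = (g.1 + j, g.2).
  move=> j0; have := E (g.1 + j, g.2).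
  have -> : x (+) y && ubit (g.1 + j, g.2) (+) z && vbit (g.1 + j, g.2) = true.
    rewrite -[LHS](E g) indic_act_set b0 !indicg eqxx -(inj_eq (can_inj (actGK k))) actGVK.
    by rewrite eq_sym (negPf kg).
  rewrite indic_act_set b0 !indicg addbF.
  have -> : (((g.1 + j, g.2) : G) == g) = false.
    by apply: contra_neqF j0 => /eqP/(congr1 fst)/= /(canRL (addKr _)); rewrite addNr.
  by rewrite ?addbF /= => /eqP e; rewrite -[in LHS]e actGVK.
have t1 : 1 != 0 :> 'Z_t by rewrite oner_eq0.
(* Now (g.1 + 1, g.2) and (g.1 - 1, g.2) are both the image of g, although 2 is
   nonzero in Z_t. *)
have := kE 1 t1; rewrite (kE (-1)) ?oppr_eq0 // => /(congr1 fst)/addrI e.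
have : 2%:R = 0 :> 'Z_t by rewrite mulr2n -{1}e addNr.
move=> /(congr1 (@nat_of_ord _)); rewrite (val_Zp_nat t_gt1) modn_small //.
lia.
Qed.

(** * Diagrammatic operations as elements of Hol(Z_t) x S_4 x Z_2 *)

Definition mkAct (r : {unit 'Z_t}) (i : 'Z_t) (s : {perm 'I_4}) : holSym :=
  (SdPair (FinRing.unit_groupAction 'Z_t) (etrans (in_setX _ _ _ _)
     (introT andP (conj (in_setT r) (in_setT i)))), s).

Lemma mkAct_eta (k : holSym) : k = mkAct k.1.1 k.1.2 k.2.
Proof. by case: k => [[[a x] p] s]; congr (_, _); apply: val_inj. Qed.

Lemma mkActM r i s r' i' s' :
  (mkAct r i s * mkAct r' i' s')%g = mkAct (r * r')%g (i * val r' + i') (s * s')%g.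
Proof. by congr (_, _); apply: val_inj. Qed.

Lemma actG_mkAct r i s g : actG (mkAct r i s) g = mkG (g.1 * val r + i) (s (pos g)).
Proof. by []. Qed.

(** F acts on S as the permutation attached to (k, b); nothing is asked of F on
    the sets themselves. *)
Definition induces (F : {set idx} -> {set idx}) k b :=
  forall D, psi (F D) = psi (act_set k b D).

Lemma induces_comp F k b F' k' b' :
  induces F k b -> induces F' k' b' -> induces (F \o F') (k' * k)%g (b' (+) b).
Proof.
by move=> FE FE' D; rewrite /= FE (psi_act_set k b (FE' D)) psi_act_setM.
Qed.

Lemma induces_act (F : {set idx} -> {set idx}) k :
  (forall D g, (index_of (actG k g) \in F D) = (index_of g \in D)) -> induces F k false.
Proof.
move=> FE D; congr psi; apply/setP => d; rewrite inE /= addbF /indic.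
by rewrite -FE actGVK eltK.
Qed.

Lemma modn4_natr (n : nat) : ((n%:R%R : idx) %% 4 = n %% 4)%N.
Proof. by rewrite (val_Zp_nat t4_gt1) modn_dvdm ?dvdn_mulr. Qed.

Lemma mem_lane_index_of e g : (e < 4)%N ->
  (index_of g \in lane t e.+1) = (pos g == e :> nat).
Proof.
move=> e4; rewrite inE modn4_natr.
by case: (pos g) e4 => p /=; case: eqP; lia.
Qed.

Lemma mem_lane_add (d : idx) n e : (d + n%:R \in lane t (e + n)) = (d \in lane t e).
Proof.
rewrite !inE -(eqn_modDr n d e); congr (_ == _).
by rewrite -(natr_Zp d) -natrD modn4_natr natr_Zp.
Qed.

Lemma mem_translate k A (d : idx) : (d \in translate k A) = (d - k \in A).
Proof.
apply/imsetP/idP => [[x xA ->]|dA]; first by rewrite addrK.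
by exists (d - k); rewrite ?subrK.
Qed.

(** Index arithmetic modulo 4t without carries: reducing j modulo t is
    invisible after multiplication by 4. *)
Lemma index_of_nat n e : index_of (mkG n%:R e) = (4 * n + e + 1)%:R.
Proof.
rewrite /index_of pos_mkG /= (val_Zp_nat t_gt1); apply: ord_inj.
by rewrite !(val_Zp_nat t4_gt1) muln_modr -addnA modnDml addnA.
Qed.

Lemma index_of_add4 (g : G) i :
  index_of (mkG (g.1 + i%:R) (pos g)) = index_of g + (4 * i)%:R.
Proof.
rewrite -{1}(natr_Zp g.1) -natrD index_of_nat /index_of -natrD mulnDr; congr (_%:R); lia.
Qed.

Lemma induces_rotation i : induces (@rotation t i) (mkAct 1%g (- i%:R) 1%g) false.
Proof.
apply: induces_act => D g.
rewrite actG_mkAct perm1 mulr1.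
set h := mkG _ _.
have -> : index_of g = index_of h + (4 * i)%:R.
  by rewrite -index_of_add4 pos_mkG /= subrK mkG_pos.
apply/bigcupP/idP => [[e _]|dD].
  by rewrite mem_translate opprK inE => /andP[].
exists (pos g); first by rewrite inE.
rewrite mem_translate opprK inE dD /= -index_of_add4 pos_mkG mem_lane_index_of //.
by rewrite pos_mkG.
Qed.

Lemma val_mulZt (x y : 'Z_t) : (x * y)%R = (x * y %% t)%N :> nat.
Proof. by congr (_ %% _)%N; rewrite Zp_cast. Qed.

Lemma induces_dilatation r : induces (dilatation r) (mkAct r 0 1%g) false.
Proof.
apply: induces_act => D g.
pose f (d : idx) : idx := (4 * ((qidx d * (val r : nat)) %% t) + cidx d)%:R.
have fE d : f d = index_of (actG (mkAct r 0 1%g) (elt d)).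
  rewrite /f -{1 2}[d]eltK qidx_index_of cidx_index_of actG_mkAct perm1 addr0 /index_of pos_mkG.
  by rewrite -addnA addn1 [_.1]/= val_mulZt.
have f_inj : injective f.
  by move=> d d'; rewrite !fE => /(can_inj index_ofK)/(can_inj (actGK _))/(can_inj eltK).
by rewrite -{1}(index_ofK g) -fE; apply: mem_imset f_inj.
Qed.

Lemma induces_swapping (a b : 'I_4) : (a < b)%N ->
  induces (@swapping t a.+1 b.+1) (mkAct 1%g 0 (tperm a b)) false.
Proof.
move=> ab; apply: induces_act => D g.
rewrite actG_mkAct mulr1 addr0.
have n_b : (b.+1 = a.+1 + (b.+1 - a.+1))%N by lia.
set h := mkG _ _.
have hpos : pos h = tperm a b (pos g) by rewrite pos_mkG.
have la x : (index_of x \in lane t a.+1) = (pos x == a) by apply: mem_lane_index_of.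
have lb x : (index_of x \in lane t b.+1) = (pos x == b) by apply: mem_lane_index_of.
rewrite /swapping /cls 2!in_setU in_setD in_setU !mem_translate opprK !in_setI la lb.
rewrite [in lane t b.+1]n_b mem_lane_add la.
rewrite -(mem_lane_add _ (b.+1 - a.+1) a.+1) -n_b subrK lb.
have up x y : x.1 = y.1 -> pos x = a -> pos y = b ->
    index_of y = index_of x + (b.+1 - a.+1)%:R.
  by move=> e pa pb; rewrite /index_of e pa pb -natrD; congr (_%:R); lia.
have [pa|pa] := eqVneq (pos g) a.
  have hb : pos h = b by rewrite hpos pa tpermL.
  rewrite hb eqxx -val_eqE gtn_eqF //= !(andbF, andbT, orbT, orbF).
  by rewrite (up g h) // addrK.
have [pb|pb] := eqVneq (pos g) b.
  have ha : pos h = a by rewrite hpos pb tpermR.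
  rewrite ha eqxx -val_eqE ltn_eqF //= !(andbF, andbT, orbT, orbF).
  by rewrite -(up h g).
have hg : h = g by rewrite /h tpermD 1?eq_sym // mkG_pos.
by rewrite hg (negPf pa) (negPf pb) !andbF.
Qed.

(** The operation complements the lane of u instead of that of uv. *)
Lemma induces_C2 : induces (@C2 t) 1%g true.
Proof.
move=> D; apply/psi_affineP.
apply: eq_affine (affine_lanes (inord 1) ord_max) => g.
rewrite indic_act_set invg1 actG1 /= uv_laneE -!val_eqE /= inordK // /indic /C2 /cls.
rewrite !(in_setU, in_setD, in_setI) !mem_lane_index_of //.
by case: (index_of g \in D) (pos g) => [] [[|[|[|[|//]]]] ?].
Qed.

(** * The bundle action *)

Definition linpart (k : holSym) (g : G) : G := ((actG k 1)^-1 * actG k g)%g.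

Lemma actG_linpart k g : (actG k 1 * linpart k g)%g = actG k g.
Proof. by rewrite mulKVg. Qed.

Lemma fst_linpart k g : (linpart k g).1 = g.1 * val k.1.1.
Proof. by rewrite fstM /= mul0r add0r addrC addrK. Qed.

Lemma bitV (p : G -> bool) (g : G) : {morph p : x y / (x * y)%g >-> x (+) y} ->
  p g^-1%g = p g.
Proof.
move=> pM; have p1 : p 1%g = false.
  by have := pM 1%g 1%g; rewrite mulg1; case: (p 1%g).
by have := pM g^-1%g g; rewrite mulVg p1; case: (p g) (p g^-1%g) => [] [].
Qed.

Lemma ubit_linpart k g :
  ubit (linpart k g) = odd (k.2 (pos 1%g)) (+) odd (k.2 (pos g)).
Proof. by rewrite ubitM (bitV _ ubitM) !ubit_mkG. Qed.
Lemma vbit_linpart k g :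
  vbit (linpart k g) = (1 < k.2 (pos 1%g))%N (+) (1 < k.2 (pos g))%N.
Proof. by rewrite vbitM (bitV _ vbitM) !vbit_mkG. Qed.

(** An affine map becomes additive once its value at 1 is removed. *)
Lemma bit_linpartM k (p : G -> bool) : {morph p : x y / (x * y)%g >-> x (+) y} ->
  affine p -> {morph p \o linpart k : x y / (x * y)%g >-> x (+) y}.
Proof.
move=> pM /(affine_actG k)/cob_eq0P aff x y.
have := aff x y; rewrite /cob /= !pM (bitV _ pM).
by case: (p _) (p _) (p _) (p _) => [] [] [] [].
Qed.

Lemma linpartM k : {morph linpart k : x y / (x * y)%g}.
Proof.
move=> x y; apply: G_ext.
- by rewrite fstM !fst_linpart -mulrDl.
- rewrite ubitM; apply: (bit_linpartM k ubitM).
  by exists false, true, false => g; rewrite addbF.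
- rewrite vbitM; apply: (bit_linpartM k vbitM).
  by exists false, false, true => g.
Qed.

Lemma linpart_mul k l g : linpart (k * l)%g g = linpart l (linpart k g).
Proof.
have -> : linpart l (linpart k g) = ((linpart l (actG k 1))^-1 * linpart l (actG k g))%g.
  by apply: (canRL (mulKg _)); rewrite -linpartM actG_linpart.
by rewrite /linpart !actGM invMg invgK -mulgA mulKVg.
Qed.

Lemma linpart_inj k : injective (linpart k).
Proof. by move=> x y /mulgI/(can_inj (actGK k)). Qed.

Lemma altform_bform g h : altform g h = bform g h (+) bform h g.
Proof.
by rewrite /altform /bform; case: (ubit g) (vbit g) (ubit h) (vbit h) => [] [] [] [].
Qed.

Lemma pos1 : pos 1%g = ord0.
Proof. by apply: val_inj; rewrite /= pos_val. Qed.

(** Since b(w, w) = 1 for all nonzero w, the forms b and b o M differ by an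
    alternating form for every linear bijection M, hence by 0 or by [altform].
    The proof finds which one by writing the permutation as a product of
    transpositions.  Both forms transform compatibly because [altform] is the
    antisymmetrisation of b. *)
Lemma bform_linpart k g h :
  bform (linpart k g) (linpart k h) = bform g h (+) odd_perm k.2 && altform g h.
Proof.
(* The form only sees the lanes. *)
wlog -> : k / k = mkAct 1%g 0 k.2 => [IH|].
  by rewrite -(IH (mkAct 1%g 0 k.2)) // /bform !ubit_linpart !vbit_linpart.
move: k.2 => s {k} /=.
have [ts -> _] := prod_tpermP s.
elim: ts g h => [|[a b] ts IH] g h.
  rewrite big_nil odd_perm1 addbF.
  have linpart1 x : linpart (mkAct 1%g 0 1%g) x = x.
    have -> : mkAct 1%g 0 1%g = 1%g by congr (_, _); apply: val_inj.
    by rewrite /linpart !actG1 invg1 mul1g.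
  by rewrite !linpart1.
rewrite big_cons /=; set s' := (\prod_(_ <- _) _)%g in IH *.
have -> : mkAct 1%g 0 (tperm a b * s')%g = (mkAct 1%g 0 (tperm a b) * mkAct 1%g 0 s')%g.
  by rewrite mkActM mulg1 mul0r addr0.
(* Both sides depend on the lanes only, so this is a finite check. *)
have base x y : bform (linpart (mkAct 1%g 0 (tperm a b)) x)
                      (linpart (mkAct 1%g 0 (tperm a b)) y)
   = bform x y (+) (a != b) && altform x y.
  rewrite /bform /altform !ubit_linpart !vbit_linpart pos1 /= -!odd_pos -!lt1_pos.
  rewrite !permE /= -!val_eqE /=.
  case: (pos x) (pos y) => [[|[|[|[|//]]]] ?] [[|[|[|[|//]]]] ?] /=;
  by case: a {IH s'} => [[|[|[|[|//]]]] ?]; case: b => [[|[|[|[|//]]]] ?].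
rewrite !linpart_mul IH odd_permM odd_tperm !altform_bform !base !altform_bform.
by case: (a != b) (odd_perm s') (bform g h) (bform h g) => [] [] [] [].
Qed.

Lemma cob_act_set k b D g h :
  cob (indic (act_set k^-1%g b D)) g h = cob (indic D \o actG k) g h (+) b && altform g h.
Proof.
rewrite -(cob_lane ord_max) /cob -!uv_laneE !indic_act_set invgK.
move: (uv_lane 1%g) (uv_lane g) (uv_lane h) (uv_lane (g * h)%g) => l1 l2 l3 l4 /=.
move: l1 l2 l3 l4 (indic D (actG k 1%g)) (indic D (actG k g)) (indic D (actG k h)).
by move: (indic D (actG k (g * h)%g)); case: b; do 8!case.
Qed.

(** The terms f(1) and f(theta(h)) cancel between the shift and its normalising
    factor, which leaves the coboundary of g |-> f(a theta(g)); the terms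
    b(a, theta(h)) cancel by bilinearity; what remains of b is given by
    [bform_linpart].  The inverse of k appears because [act_set] moves sets
    forwards whereas the bundle action precomposes. *)
Lemma bundle_psi a (theta : {perm G}) k D :
  theta \in Aut [set: G] -> (forall g, (a * theta g)%g = actG k g) ->
  bundle a theta (psi D) = psi (act_set k^-1%g (odd_perm k.2) D).
Proof.
move=> /Aut_morphic/morphicP thetaM kE.
have theta1 : theta 1%g = 1%g.
  by apply: (mulgI (theta 1%g)); rewrite -thetaM ?in_setT // !mulg1.
have aE : a = actG k 1%g by rewrite -kE theta1 mulg1.
have thetaE g : theta g = linpart k g by apply: (mulgI a); rewrite kE aE actG_linpart.
apply/ffunP => -[g h].
rewrite [LHS]ffunE /= [LHS]ffunE /= !psiE signV -signr_addb; congr (_ ^+ nat_of_bool _).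
rewrite cob_act_set bformDl !thetaE bform_linpart /cob /= -mulgA -linpartM aE !actG_linpart.
move: (indic D 1%g) (indic D (linpart k h)) (bform (actG k 1%g) (linpart k h)) (bform g h).
move: (indic D (actG k 1%g)) (indic D (actG k g)) (indic D (actG k h)).
move: (indic D (actG k (g * h)%g)).
by case: (odd_perm k.2 && altform g h); do 8!case.
Qed.

(** The affine bijection attached to k splits as a translation followed by its
    linear part, which is an automorphism. *)
Lemma act_of_bundle k : exists a, exists2 theta : {perm G},
  theta \in Aut [set: G] & forall g, (a * theta g)%g = actG k g.
Proof.
exists (actG k 1%g); exists (perm (@linpart_inj k)); last first.
  by move=> g; rewrite permE actG_linpart.
rewrite inE; apply/andP; split; first by apply/subsetP => g _; rewrite inE.
by apply/morphicP => g h _ _; rewrite !permE linpartM.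
Qed.

(** As t is odd, an automorphism of G preserves both the squares, which are the
    factor Z_t, and the elements of order dividing 2, which are the Klein
    factor.  On Z_t it is the multiplication by the image of 1. *)
Lemma bundle_of_act a (theta : {perm G}) : theta \in Aut [set: G] ->
  exists k, forall g, (a * theta g)%g = actG k g.
Proof.
move=> /Aut_morphic/morphicP thetaM_in.
have thetaM x y : theta (x * y)%g = (theta x * theta y)%g.
  by apply: thetaM_in; rewrite in_setT.
have dec (g : G) : g = ((g.1, 1) * (0%R, g.2))%g.
  by apply: G_ext; rewrite ?(ubitM, vbitM) // fstM /= addr0.
have theta_x j : ubit (theta (j, 1%g)) = false /\ vbit (theta (j, 1%g)) = false.
  have [i ->] := half_Zt j.
  have -> : (i + i, 1%g) = ((i, 1%g) * (i, 1%g) : G)%g by apply: G_ext.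
  by rewrite thetaM ubitM vbitM !addbb.
have theta_w (w : 'Z_2 * 'Z_2) : (theta ((0%R, w) : G)).1 = 0.
  set z := (theta _).1.
  have zz : z + z = 0.
    rewrite /z -fstM -thetaM.
    have -> : (((0%R, w) : G) * ((0%R, w) : G))%g = 1%g.
      by apply: G_ext; rewrite ?(ubitM, vbitM) ?addbb // fstM addr0.
    by have -> : theta 1%g = 1%g by apply: (mulgI (theta 1%g)); rewrite -thetaM !mulg1.
  (* 2z = 0 and tz = 0 with t odd. *)
  have -> : z = (z + z) *+ (t.+1)./2 - z *+ t.
    rewrite -mulr2n -mulrnA -mulrnBr; last lia.
    by have -> : (2 * (t.+1)./2 - t = 1)%N by lia.
  by rewrite zz mul0rn sub0r -mulr_natr pchar_Zp // mulr0 oppr0.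
pose al j := (theta (j, 1%g)).1.
have alD i j : al (i + j) = al i + al j.
  rewrite /al -fstM -thetaM; congr (theta _).1; exact: G_ext.
have al0 : al 0 = 0 by apply: theta_w.
have alE j : al j = j * al 1.
  rewrite -(natr_Zp j); elim: (j : nat) => [|n IH]; first by rewrite mul0r.
  by rewrite -natr1 alD IH mulrDl mul1r.
have thetaE g : (theta g).1 = g.1 * al 1.
  by rewrite [in LHS](dec g) thetaM fstM theta_w addr0 -alE.
have al_unit : al 1 \is a GRing.unit.
  apply/unitrPr; exists ((theta^-1%g (1, 1%g)).1).
  by rewrite mulrC -thetaE permKV.
pose s (e : 'I_4) := pos (a * theta (mkG 0 e))%g.
have pos_theta g : pos (a * theta g)%g = s (pos g).
  apply: val_inj; rewrite /= /s !pos_val !ubitM !vbitM.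
  have -> : mkG 0 (pos g) = (0, g.2).
    by apply: G_ext; rewrite ?ubit_mkG ?vbit_mkG ?odd_pos ?lt1_pos.
  rewrite [in theta g](dec g) thetaM !ubitM !vbitM.
  by have [-> ->] := theta_x g.1.
have s_inj : injective s.
  move=> e e' ss; rewrite -[e](pos_mkG 0) -[e'](pos_mkG 0); congr pos.
  apply: (@perm_inj _ theta); apply: (mulgI a).
  rewrite -[LHS]mkG_pos -[RHS]mkG_pos; congr mkG => //.
  by rewrite !fstM !thetaE.
exists (mkAct (FinRing.unit 'Z_t al_unit) a.1 (perm s_inj)) => g.
by rewrite actG_mkAct permE -pos_theta -[LHS]mkG_pos fstM thetaE addrC.
Qed.

Lemma bundle_act_perm a (theta : {perm G}) k (s : calS) :
  theta \in Aut [set: G] -> (forall g, (a * theta g)%g = actG k g) ->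
  ssval (act_perm k^-1%g (odd_perm k.2) s) = bundle a theta (ssval s).
Proof.
move=> thetaA kE; have [D ->] := psiS_onto s.
by rewrite act_permE /= (bundle_psi D thetaA kE).
Qed.

(** * The group H* is the graph of the sign *)

(** The graph of the sign of the lane permutation, inside
    (Hol(Z_t) x S_4) x Z_2. *)
Definition signed_act (k : holSym) : {perm calS} := act_perm k (odd_perm k.2).

Lemma signed_actM : {in [set: holSym] &, {morph signed_act : k l / (k * l)%g}}.
Proof. by move=> k l _ _; rewrite /signed_act odd_permM act_permM. Qed.

Canonical signed_act_morphism := Morphism signed_actM.

Lemma injm_signed_act : ('injm signed_act)%g.
Proof. by apply/subsetP => k /mker/act_perm_inj[-> _]; rewrite inE. Qed.

Lemma mem_signed_act k : signed_act k \in (signed_act @* [set: holSym])%g.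
Proof. by rewrite mem_morphim ?inE. Qed.

Lemma bundle_perms_signed : bundle_perms t = (signed_act @* [set: holSym])%g.
Proof.
apply/setP => p; apply/idP/idP.
  rewrite inE => /existsP[a /exists_inP[theta thetaA /forallP pE]].
  have [k kE] := bundle_of_act a thetaA.
  suff -> : p = signed_act k^-1%g by apply: mem_signed_act.
  apply/permP => s; apply: val_inj; rewrite /= (eqP (pE s)).
  by rewrite -(bundle_act_perm s thetaA kE) /signed_act odd_permV.
case/morphimP => k _ _ ->.
have [a [theta thetaA kE]] := act_of_bundle k^-1%g.
rewrite inE; apply/existsP; exists a; apply/exists_inP; exists theta => //.
apply/forallP => s; rewrite -(bundle_act_perm s thetaA kE).
by rewrite invgK odd_permV.
Qed.

Lemma act_perm_signed k b :
  act_perm k b = (signed_act k * act_perm 1%g (b (+) odd_perm k.2))%g.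
Proof. by rewrite -act_permM mulg1 addbCA addbb addbF. Qed.

Definition flip : {perm calS} := op_perm (@C2 t).

Lemma flipE : flip = act_perm 1%g true.
Proof. exact: op_perm_induced induces_C2. Qed.

Lemma diag_induces F : diag_op F -> exists k b, induces F k b.
Proof.
case=> [|a b /andP[a0 ab] b4|i _|r].
- by exists 1%g, true; apply: induces_C2.
- case: a b a0 ab b4 => [|a] [|b] // _ ab b4.
  have a4 : (a < 4)%N by apply: ltn_trans b4.
  by have := @induces_swapping (Ordinal a4) (Ordinal b4) ab; eexists; eexists; eassumption.
- by eexists; eexists; apply: induces_rotation.
- by eexists; eexists; apply: induces_dilatation.
Qed.

(* Position e is the lane of the indices congruent to e + 1 modulo 4. *)
Let i0 : 'I_4 := @Ordinal 4 0 isT.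
Let i1 : 'I_4 := @Ordinal 4 1 isT.
Let i2 : 'I_4 := @Ordinal 4 2 isT.
Let i3 : 'I_4 := @Ordinal 4 3 isT.

Definition lane_perm (s : {perm 'I_4}) : holSym := mkAct 1%g 0 s.

Lemma lane_permM : {in [set: {perm 'I_4}] &, {morph lane_perm : s s' / (s * s')%g}}.
Proof. by move=> s s' _ _; rewrite /lane_perm mkActM mulg1 mul0r addr0. Qed.
Canonical lane_perm_morphism := Morphism lane_permM.

Lemma op_perm_signed F k b : induces F k b -> b = odd_perm k.2 ->
  op_perm F = signed_act k.
Proof. by move=> FE be; rewrite (op_perm_induced FE) be. Qed.

Lemma op_rotation1 : op_perm (@rotation t 1) = signed_act (mkAct 1%g (-1) 1%g).
Proof. by apply: op_perm_signed (induces_rotation 1) _; rewrite odd_perm1. Qed.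
Lemma op_dilatation r : op_perm (dilatation r) = signed_act (mkAct r 0 1%g).
Proof. by apply: op_perm_signed (induces_dilatation r) _; rewrite odd_perm1. Qed.
Lemma op_two_swappings (a b c d : 'I_4) : (a < b)%N -> (c < d)%N ->
  op_perm (@swapping t a.+1 b.+1 \o swapping c.+1 d.+1)
  = signed_act (lane_perm (tperm c d * tperm a b)%g).
Proof.
move=> ab cd.
have FE := induces_comp (induces_swapping ab) (induces_swapping cd).
apply: op_perm_signed _; first by rewrite lane_permM ?in_setT //; apply: FE.
by rewrite odd_permM !odd_tperm -!val_eqE /= !ltn_eqF.
Qed.
Lemma op_C2_swapping (a b : 'I_4) : (a < b)%N ->
  op_perm (@C2 t \o swapping a.+1 b.+1) = signed_act (lane_perm (tperm a b)).
Proof.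
move=> ab.
have FE := induces_comp induces_C2 (induces_swapping ab).
rewrite mulg1 in FE; apply: op_perm_signed FE _.
by rewrite odd_tperm -val_eqE /= ltn_eqF.
Qed.

(** The given generators lie in the graph by the parity of their lane
    permutations.  Conversely T_1 and the dilatations give Hol(Z_t), and the
    lane permutations (12), (13)(12), (23)(01), on lanes numbered from 0 to 3,
    give the transpositions (1 y) for all y, which generate S_4. *)
Lemma Hstar_signed : Hstar t = (signed_act @* [set: holSym])%G.
Proof.
apply/eqP; rewrite -val_eqE /= eqEsubset; apply/andP; split.
  rewrite gen_subG; apply/subsetP => p.
  case/setUP => [/setUP[/set1P->|/imsetP[r _ ->]]|].
  - by rewrite op_rotation1 mem_signed_act.
  - by rewrite op_dilatation mem_signed_act.
  case/setUP => [/setUP[/setUP[]|]|] /set1P ->.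
  - by rewrite (@op_two_swappings i0 i1 i2 i3) // mem_signed_act.
  - by rewrite (@op_two_swappings i0 i2 i1 i3) // mem_signed_act.
  - by rewrite (@op_C2_swapping i1 i2) // mem_signed_act.
  - by rewrite (@op_two_swappings i1 i2 i1 i3) // mem_signed_act.
apply/subsetP => p /morphimP[k _ _ ->] {p}.
have genH p : p \in [set op_perm (swapping 1 2 \o swapping 3 4);
    op_perm (swapping 1 3 \o swapping 2 4); op_perm (@C2 t \o swapping 2 3);
    op_perm (swapping 2 3 \o swapping 2 4)] -> p \in Hstar t.
  by move=> pH; apply/mem_gen/setUP; right.
have rotH i : signed_act (mkAct 1%g i 1%g) \in Hstar t.
  have -> : mkAct 1%g i 1%g = (mkAct 1%g (-1)%R 1%g ^+ (- i)%R)%g.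
    rewrite -[in LHS](opprK i) -[in LHS](natr_Zp (- i)).
    elim: (nat_of_ord (- i)%R) => [|n IH].
      by rewrite oppr0; congr (_, _); apply: val_inj.
    by rewrite expgSr -IH mkActM !mulg1 mulr1 -natr1 opprD.
  rewrite morphX ?in_setT //; apply: groupX; rewrite /= -op_rotation1.
  by apply/mem_gen/setUP; left; apply/setUP; left; apply: set11.
have dilH r : signed_act (mkAct r 0 1%g) \in Hstar t.
  rewrite -op_dilatation -[r]invgK; apply/mem_gen/setUP; left; apply/setUP; right.
  exact: (imset_f (fun r => op_perm (dilatation r^-1%g))).
pose pullback := [set s | signed_act (lane_perm s) \in Hstar t].
have pullback_group : group_set pullback.
  apply/group_setP; split=> [|s s']; rewrite ![_ \in pullback]in_set.
    by rewrite !morph1 group1.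
  by rewrite !morphM ?in_setT //; apply: groupM.
pose M := Group pullback_group.
have MP s : (s \in M) = (signed_act (lane_perm s) \in Hstar t) by rewrite in_set.
have permH s : signed_act (lane_perm s) \in Hstar t.
  rewrite -MP; apply: subsetP (in_setT s); rewrite -(gen_tperm i1) gen_subG.
  have m12 : tperm i1 i2 \in M.
    by rewrite MP -op_C2_swapping //; apply/genH/setUP; left; apply/setUP; right; apply: set11.
  have m13 : tperm i1 i3 \in M.
    rewrite -(groupMr _ m12) MP -op_two_swappings //.
    by apply/genH/setUP; right; apply: set11.
  have m23 : tperm i2 i3 \in M.
    have -> : tperm i2 i3 = (tperm i1 i2 ^ tperm i1 i3)%g.
      by rewrite tpermJ tpermL tpermD // tpermC.
    exact: groupJ.
  have m01 : tperm i0 i1 \in M.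
    rewrite -(groupMl _ m23) MP -op_two_swappings //.
    by apply/genH/setUP; left; apply/setUP; left; apply/setUP; left; apply: set11.
  apply/subsetP => _ /imsetP[y _ ->].
  have [->|[->|[->|->]]] : y = i0 \/ y = i1 \/ y = i2 \/ y = i3.
    case: y => [[|[|[|[|//]]]] y4]; [left|right;left|right;right;left|right;right;right];
    exact: val_inj.
  - by rewrite tpermC.
  - by rewrite tperm1 group1.
  - exact: m12.
  - exact: m13.
have -> : k = (mkAct k.1.1 0 1 * (mkAct 1 k.1.2 1 * lane_perm k.2))%g.
  by rewrite /lane_perm !mkActM !mul1g !mulg1 !mulr1 addr0 add0r -mkAct_eta.
by rewrite !morphM ?in_setT // !groupM.
Qed.

Lemma act_perm_id b : act_perm 1%g b = if b then flip else 1%g.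
Proof. by case: b; rewrite ?flipE ?act_perm1. Qed.

Lemma flip_notin : flip \notin Hstar t.
Proof.
rewrite Hstar_signed; apply/negP => /morphimP[k _ _ fk].
have : act_perm (k^-1 * 1)%g (odd_perm k.2 (+) true) = 1%g.
  have -> : act_perm (k^-1 * 1)%g (odd_perm k.2 (+) true) =
      (signed_act k^-1 * signed_act k)%g.
    by rewrite -fk /signed_act odd_permV flipE act_permM.
  by rewrite -signed_actM ?in_setT // mulVg /signed_act odd_perm1 act_perm1.
move=> /act_perm_inj[]; rewrite mulg1 => /(canRL invgK) ->.
by rewrite invg1 odd_perm1.
Qed.

(** * Index of H* in H' *)

(** H' is generated by H* and C_2: a single swapping is the product of C_2 with
    an element of the graph. *)
Lemma Hprime_join : Hprime t = (Hstar t <*> <[flip]>)%G.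
Proof.
set J := (Hstar t <*> <[flip]>)%G.
have flipJ : flip \in J by apply: subsetP (joing_subr _ _) _ (cycle_id flip).
have signedJ k : signed_act k \in J.
  by apply: subsetP (joing_subl _ _) _ _; rewrite Hstar_signed mem_signed_act.
have act_permJ k b : act_perm k b \in J.
  rewrite act_perm_signed; apply: groupM; first exact: signedJ.
  by rewrite act_perm_id; case: ifP => _; [exact: flipJ | exact: group1].
have opD F : diag_op F -> op_perm F \in J.
  by move=> /diag_induces[k [b FE]]; rewrite (op_perm_induced FE); apply: act_permJ.
apply/eqP; rewrite -val_eqE /= eqEsubset; apply/andP; split.
  rewrite gen_subG; apply/subsetP => p.
  case/setUP => [/setUP[/setUP[/set1P->|/imsetP[[a b] + ->]]|]|].
  - exact/opD/DiagComplement.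
  - by rewrite inE => ab; apply/opD/DiagSwap => //; rewrite -ltnS ltn_ord.
  - by case/imsetP => i _ ->; apply/opD/DiagRot.
  - by case/imsetP => r _ ->; apply/opD/DiagDil.
have gC2 : op_perm (@C2 t) \in Hprime t.
  by apply/mem_gen/setUP; left; apply/setUP; left; apply/setUP; left; apply: set11.
have gS a b : (0 < a < b)%N -> (b <= 4)%N -> op_perm (@swapping t a b) \in Hprime t.
  move=> ab b4; have a4 : (a < 5)%N by case/andP: ab; lia.
  apply/mem_gen; rewrite in_setU; apply/orP; left; rewrite in_setU; apply/orP; left.
  apply/setUP; right; apply/imsetP.
  by exists (Ordinal a4, @Ordinal 5 b b4); rewrite ?inE.
have gR i : (i < t)%N -> op_perm (@rotation t i) \in Hprime t.
  move=> it; apply/mem_gen; rewrite in_setU; apply/orP; left; apply/setUP; right.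
  by apply/imsetP; exists (Ordinal it).
have gD r : op_perm (@dilatation t r) \in Hprime t.
  by apply/mem_gen/setUP; right; apply/imsetP; exists r.
have comp (F F' : {set idx} -> {set idx}) : diag_op F -> diag_op F' ->
    op_perm (F \o F') = (op_perm F' * op_perm F)%g.
  move=> /diag_induces[k [b FE]] /diag_induces[k' [b' FE']].
  rewrite (op_perm_induced FE) (op_perm_induced FE') -act_permM.
  exact/op_perm_induced/induces_comp.
rewrite join_subG cycle_subG gC2 andbT gen_subG; apply/subsetP => p.
have sD a b : (0 < a < b)%N -> (b <= 4)%N -> diag_op (@swapping t a b) by apply: DiagSwap.
have cD : diag_op (@C2 t) by apply: DiagComplement.
case/setUP => [/setUP[/set1P->|/imsetP[r _ ->]]|]; first exact: gR.
  exact: gD.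
case/setUP => [/setUP[/setUP[]|]|] /set1P ->;
  (rewrite comp; [apply: groupM | | ]).
- exact: gS.
- exact: gS.
- exact: sD.
- exact: sD.
- exact: gS.
- exact: gS.
- exact: sD.
- exact: sD.
- exact: gS.
- exact: gC2.
- exact: cD.
- exact: sD.
- exact: gS.
- exact: gS.
- exact: sD.
- exact: sD.
Qed.

(** C_2 is a central involution outside H*, so H' is the direct product of H*
    and the group of order 2 that it generates. *)
Lemma Hprime_index : #|Hprime t : Hstar t|%g = 2%N.
Proof.
have flip2 : #[flip]%g = 2%N.
  apply: nt_prime_order => //.
    by rewrite expgS expg1 flipE -act_permM mulg1 act_perm1.
  by apply: contraNneq flip_notin => ->; apply: group1.
have TI : (Hstar t :&: <[flip]> = 1)%g.
  by rewrite setIC; apply: prime_TIg; rewrite -?orderE ?flip2 // cycle_subG flip_notin.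
have cH : (<[flip]> \subset 'C(Hstar t))%g.
  rewrite cycle_subG Hstar_signed; apply/centP => _ /morphimP[k _ _ ->].
  by rewrite /commute flipE /= /signed_act -!act_permM mul1g mulg1 addbC.
rewrite Hprime_join -divgS ?joing_subl //= cent_joinEr // TI_cardMg //.
by rewrite -orderE flip2 mulKn ?cardG_gt0.
Qed.

Lemma Hstar_isog : (Hstar t \isog [set: holSym])%g.
Proof.
rewrite Hstar_signed isog_sym; apply/isogP.
by exists signed_act_morphism; rewrite ?injm_signed_act.
Qed.

Lemma Hstar_Hprime : Hstar t \subset Hprime t.
Proof. by rewrite Hprime_join joing_subl. Qed.

Lemma op_perm_diag (F : {set idx} -> {set idx}) D : diag_op F ->
  op_perm F (psiS D) = psiS (F D).
Proof.
move=> /diag_induces[k [b FE]].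
by rewrite (op_perm_induced FE) act_permE; apply/psiS_eqP; rewrite FE.
Qed.

Lemma bundle_permutes a (theta : {perm G}) : theta \in Aut [set: G] ->
  exists p : {perm calS}, forall s, ssval (p s) = bundle a theta (ssval s).
Proof.
move=> thetaA; have [k kE] := bundle_of_act a thetaA.
by exists (act_perm k^-1%g (odd_perm k.2)) => s; apply: bundle_act_perm.
Qed.

End DiagrammaticOperations.

Theorem theorem4 (t : nat) (t_gt1 : (1 < t)%N) (t_odd : odd t) :
  (* S consists of cocycles; each diagrammatic operation is a well-defined
     permutation of S; and each element of H permutes S *)
  [/\ forall D : {set idx t}, cocycle (psi D),
      forall F, diag_op F ->
        forall D : {set idx t}, op_perm F (psiS D) = psiS (F D)
    & forall (a : G t) (theta : {perm G t}), theta \in Aut [set: G t] ->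
        exists p : {perm calS t},
          forall s : calS t, ssval (p s) = bundle a theta (ssval s)]
  /\
  [/\ bundle_perms t = Hstar t :> {set {perm calS t}},
      Hstar t \isog
        [set: sdprod_by (FinRing.unit_groupAction 'Z_t) * {perm 'I_4}],
      Hstar t \subset Hprime t,
      #|Hprime t : Hstar t|%g = 2
    & op_perm (@C2 t) \notin Hstar t].
Proof.
split; split.
- exact: psi_cocycle.
- by move=> F /op_perm_diag FE D; apply: FE.
- exact: bundle_permutes.
- by rewrite bundle_perms_signed // Hstar_signed.
- exact: Hstar_isog.
- exact: Hstar_Hprime.
- exact: Hprime_index.
- exact: flip_notin.
Qed.
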